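(* Up to equivalence, there are exactly six nontrivial MDS codes over $\mathbb{F}_5$. Precisely, if $C$ is a nontrivial MDS $[n,k,d]_5$ code, then, up to equivalence, $C$ is one of the following codes (one code for each of the listed parameter triples): (i) a completely regular $[6,4,3]_5$ code, or its dual $[6,2,5]_5$ code, which is not uniformly packed in the wide sense; (ii) a $[6,3,4]_5$ code, which is not uniformly packed in the wide sense; a self-dual version of such a code exists (i.e. there is a self-dual $[6,3,4]_5$ code); (iii) a completely regular $[5,3,3]_5$ code, or its dual $[5,2,4]_5$ code, which is uniformly packed in the wide sense; (iv) a $[4,2,3]_5$ code, which is completely regular and not self-dual.
   Context: $\mathbb{F}_q$ is the finite field of order $q$. An $[n,k,d]_q$ code $C$ is a $k$-dimensional linear subspace of $\mathbb{F}_q^n$ with minimum Hamming distance $d$. $C$ is MDS if $d=n-k+1$; an MDS $[n,k,d]_q$ code is nontrivial if $2\le k\le n-2$. Two linear codes in $\mathbb{F}_5^n$ are equivalent if one is the image of the other under a monomial transformation (a permutation of coordinates together with multiplication of coordinates by nonzero scalars). The dual is $C^\perp=\{\mathbf{x}\in\mathbb{F}_q^n : \mathbf{x}\cdot\mathbf{v}=0\ \forall \mathbf{v}\in C\}$ for the Euclidean inner product $\mathbf{v}\cdot\mathbf{u}=\sum_{i=1}^n v_iu_i$, and $C$ is self-dual if $C=C^\perp$. For $\mathbf{v}\in\mathbb{F}_q^n$, $d(\mathbf{v},C)=\min\{d(\mathbf{v},\mathbf{x}) : \mathbf{x}\in C\}$ (Hamming distance), and for $t\in\{0,\dots,n\}$,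 $B_{\mathbf{v},t}=|\{\mathbf{x}\in C : d(\mathbf{v},\mathbf{x})=t\}|$. The covering radius is $\rho=\max_{\mathbf{v}\in\mathbb{F}_q^n} d(\mathbf{v},C)$. $C$ is completely regular if $B_{\mathbf{v},t}$ depends only on $t$ and $d(\mathbf{v},C)$. $C$ is uniformly packed in the wide sense if there exist rational numbers $\beta_0,\dots,\beta_\rho$ such that $\sum_{i=0}^{\rho}\beta_i B_{\mathbf{x},i}=1$ for every $\mathbf{x}\in\mathbb{F}_q^n$. *)

(* Defs.v *)
From HB Require Import structures.
From mathcomp Require Import all_boot all_order all_algebra.

Set Implicit Arguments.
Unset Strict Implicit.
Unset Printing Implicit Defensive.

Import GRing.Theory.
Local Open Scope ring_scope.

(* The length is bundled so that codes of different lengths can be compared. *)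
Record linear_code (F : fieldType) := LinearCode {
  code_length : nat;
  codewords :> {vspace 'rV[F]_code_length}
}.

Section Words.
Variables (F : fieldType) (n : nat).

Definition hamming_dist (x y : 'rV[F]_n) : nat :=
  #|[set i | x 0 i != y 0 i]|.

Definition inner (v u : 'rV[F]_n) : F := \sum_i v 0 i * u 0 i.

End Words.

Section Codes.
Variable F : finFieldType.
Implicit Types C D : linear_code F.

Definition min_distance C (d : nat) : Prop :=
  (exists x y : 'rV[F]_(code_length C),
     [/\ x \in codewords C, y \in codewords C, x != y & hamming_dist x y = d])
  /\ (forall x y : 'rV[F]_(code_length C),
     x \in codewords C -> y \in codewords C -> x != y ->
     (d <= hamming_dist x y)%N).

Definition code_with_params (n k d : nat) C : Prop :=
  [/\ code_length C = n, \dim (codewords C) = k & min_distance C d].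

Definition nontrivial_MDS (n k d : nat) C : Prop :=
  [/\ code_with_params n k d C, d = (n - k + 1)%N & (2 <= k <= n - 2)%N].

Definition dual_code C : linear_code F :=
  LinearCode (\bigcap_(v : 'rV[F]_(code_length C) | v \in codewords C)
                lker (linfun (mulmxr v^T)))%VS.

Lemma mem_dual_code C (x : 'rV[F]_(code_length C)) :
  reflect (forall v, v \in codewords C -> inner x v = 0)
          (x \in codewords (dual_code C)).
Proof.
have mulE (v : 'rV[F]_(code_length C)) :
    (x *m v^T == 0) = (inner x v == 0).
  have E : (x *m v^T) 0 0 = inner x v.
    by rewrite mxE; apply: eq_bigr => i _; rewrite mxE.
  apply/eqP/eqP => [xv0|xv0]; first by rewrite -E xv0 mxE.
  by apply/matrixP => i j; rewrite !ord1 E xv0 mxE.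
apply: (iffP idP) => [xC v vC|xC].
  move: xC; rewrite memvE => /subv_bigcapP/(_ v vC).
  by rewrite -memvE memv_ker lfunE /= mulE => /eqP.
rewrite memvE; apply/subv_bigcapP => v vC.
by rewrite -memvE memv_ker lfunE /= mulE xC.
Qed.

Definition self_dual C : Prop := codewords C = codewords (dual_code C).

(* Bijectivity of s forces equal lengths, so s is a permutation of the
   coordinates and x |-> (a_j x_(s j))_j is a monomial transformation. *)
Definition equivalent C D : Prop :=
  exists (s : 'I_(code_length D) -> 'I_(code_length C))
         (a : 'I_(code_length D) -> F),
  [/\ bijective s, forall j, a j != 0 &
      [set y | y \in codewords D] =
      [set \row_j (a j * x 0 (s j))
         | x : 'rV[F]_(code_length C) in codewords C]].

(* The search for the minimum starts from 0, which is a codeword. *)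
Definition dist_to_code C (v : 'rV[F]_(code_length C)) : nat :=
  hamming_dist v [arg min_(x < 0 in codewords C) hamming_dist v x].

Definition outer_count C (v : 'rV[F]_(code_length C)) (t : nat) : nat :=
  #|[set x in codewords C | hamming_dist v x == t]|.

Definition covering_radius C : nat :=
  \max_(v : 'rV[F]_(code_length C)) dist_to_code v.

Definition completely_regular C : Prop :=
  forall (v w : 'rV[F]_(code_length C)) (t : 'I_(code_length C).+1),
  dist_to_code v = dist_to_code w -> outer_count v t = outer_count w t.

Definition uniformly_packed_wide C : Prop :=
  exists beta : 'I_(covering_radius C).+1 -> rat,
  forall x : 'rV[F]_(code_length C),
  \sum_i beta i * (outer_count x i)%:R = 1.

End Codes.

(* Main.v *)
Require Import Defs.
From mathcomp Require Import all_boot all_order all_algebra.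
From mathcomp Require Import all_fingroup all_field zify ring lra.

Set Implicit Arguments.
Unset Strict Implicit.
Unset Printing Implicit Defensive.

(** A nontrivial MDS code has information set the first k coordinates, so it has
a generator matrix [I | A], and it is MDS exactly when u and u A together have
weight more than m = n - k for every nonzero u. Everything is read off the
k x m matrix A.

Classification. Scaling rows and columns of A, and permuting them, are
monomial transformations of the code. In an MDS code A has no zero entry and no
zero 2 x 2 minor, so after scaling the first row and column to 1 the remaining
entries form an array over {2, 3, 4} without repetition in a row or a column.
Hence k, m <= 4; the 3 x 4 and 4 x 3 arrays turn out to have a zero minor
([regular_forms_nil]), which leaves the six shapes of the theorem. For every
shape but 2 x 2, running through the few arrays that remain shows that they are
all related by such scalings and permutations ([unique_MDS_class]). For the
shape 2 x 2 the invariant is a cross-ratio a in {2, 3, 4}, row and column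
permutations only invert it, and the exchange of an information coordinate with a
check coordinate provides the missing a -> a / (a - 1)
([harmonic_equivalent]). Length and dimension separate the six classes.

Metric properties. The distribution of distances from a vector v to the code
depends only on the coset of v, that is on a syndrome s, and is the distribution
of weight u + weight (s + u A) over all u. The list of all coset distributions
of a code ([systematic_table]) determines its minimum distance, covering radius,
complete regularity and the linear system that expresses uniform packing. For
the six codes there are 2 to 6 distinct distributions, which are computed: the
distributions of the [6,4], [5,3] and [4,2] codes are distinguished by the
distance to the code; the systems of the [6,2] and [6,3] codes are inconsistent
and that of the [5,2] code is solvable.

Duality. Orthogonality of generator matrices together with complementary
dimensions gives duality ([gencode_dual]); for the [6,3] code a circulant A with
A A^T = -I gives a self-dual representative. No code equivalent to the [4,2] one
is self-dual: it has a word of weight 3, and nonzero squares of F_5 are 1 and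
-1, three of which never add up to 0 ([weight3_anisotropic]). *)
Import GRing.Theory.
Local Open Scope ring_scope.

(** * Codes given by generator matrices *)

Section GeneratorMatrices.
Variable F : finFieldType.

Definition gencode k n (G : 'M[F]_(k, n)) : linear_code F :=
  LinearCode (limg (linfun (mulmxr G))).

Lemma mem_gencode k n (G : 'M[F]_(k, n)) (x : 'rV[F]_n) :
  reflect (exists u, x = u *m G) (x \in codewords (gencode G)).
Proof.
apply: (iffP memv_imgP) => [[u _ ->]|[u ->]]; exists u; rewrite ?memvf //;
by rewrite lfunE.
Qed.

Lemma dim_gencode k n (G : 'M[F]_(k, n)) :
  row_free G -> \dim (codewords (gencode G)) = k.
Proof.
move=> freeG; rewrite limg_dim_eq ?dimvf ?dim_matrix ?mul1r //.
apply/eqP; rewrite -subv0 capfv; apply/subvP => u.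
rewrite memv_ker lfunE /= memv0 => uG0.
by rewrite -(inj_eq (row_free_inj freeG)) mul0mx.
Qed.

Lemma inner_mulmx n (x y : 'rV[F]_n) : inner x y = (x *m y^T) 0 0.
Proof. by rewrite mxE; apply: eq_bigr => i _; rewrite mxE. Qed.

(** The dual is the kernel of x |-> x G^T, which maps onto F^k because G has full
row rank. *)
Lemma dim_dual_gencode k n (G : 'M[F]_(k, n)) :
  row_free G -> (\dim (codewords (dual_code (gencode G))) + k = n)%N.
Proof.
move=> freeG.
pose f : 'Hom('rV[F]_n, 'rV[F]_k) := linfun (mulmxr G^T).
have -> : codewords (dual_code (gencode G)) = lker f.
  apply/vspaceP => x; rewrite memv_ker lfunE /=.
  apply/(@mem_dual_code _ (gencode G) x)/eqP => [xG|xG v /mem_gencode[u ->]]; last first.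
    by rewrite inner_mulmx trmx_mul mulmxA xG mul0mx mxE.
  apply/rowP => i; rewrite !mxE.
  rewrite -[RHS](xG (row i G)); first by apply: eq_bigr => j _; rewrite !mxE.
  by apply/mem_gencode; exists (delta_mx 0 i); rewrite rowE.
have imf : \dim (limg f) = k.
  suff -> : limg f = fullv by rewrite dimvf dim_matrix mul1r.
  apply/vspaceP => y; rewrite memvf.
  have fullG : row_full G^T by rewrite /row_full mxrank_tr.
  apply/memv_imgP; exists (y *m pinvmx G^T); rewrite ?memvf // lfunE /=.
  by rewrite mulmxKpV // submx_full.
by have := limg_ker_dim f fullv; rewrite imf capfv dimvf dim_matrix mul1r.
Qed.

(** Orthogonality of the generators gives one inclusion, the dimensions give
equality. *)
Lemma gencode_dual k m n (G : 'M[F]_(k, n)) (H : 'M[F]_(m, n)) :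
  row_free G -> row_free H -> (m + k = n)%N -> H *m G^T = 0 ->
  codewords (gencode H) = codewords (dual_code (gencode G)).
Proof.
move=> freeG freeH mkn HG.
apply/eqP; rewrite eqEdim; apply/andP; split; last first.
  have e := dim_dual_gencode freeG; rewrite -(leq_add2r k) e.
  by rewrite dim_gencode // mkn.
apply/subvP => x /mem_gencode[u ->].
apply/(@mem_dual_code _ (gencode G)) => v /mem_gencode[w ->].
by rewrite inner_mulmx trmx_mul mulmxA -(mulmxA u) HG mulmx0 mul0mx mxE.
Qed.

(** * Systematic codes *)

Definition weight n (x : 'rV[F]_n) := #|[set i | x 0 i != 0]|.

Lemma hamming_weight n (x y : 'rV[F]_n) : hamming_dist x y = weight (x - y).
Proof. by apply: eq_card => i; rewrite !inE !mxE subr_eq0. Qed.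

Lemma weightE n (x : 'rV[F]_n) : weight x = (\sum_i (x 0 i != 0)%R)%N.
Proof. by rewrite /weight -sum1dep_card big_mkcond; apply: eq_bigr => i; case: eqP. Qed.

Lemma weight_row_mx m n (x : 'rV[F]_m) (y : 'rV[F]_n) :
  weight (row_mx x y) = (weight x + weight y)%N.
Proof.
rewrite !weightE big_split_ord; congr (_ + _)%N; apply: eq_bigr => i _.
  by rewrite row_mxEl.
by rewrite row_mxEr.
Qed.

Lemma weight_eq0 n (x : 'rV[F]_n) : (weight x == 0)%N = (x == 0).
Proof.
rewrite cards_eq0; apply/eqP/eqP => [/setP x0|->].
  by apply/rowP => i; move/(_ i): x0; rewrite !inE mxE => /negbFE/eqP.
by apply/setP => i; rewrite !inE mxE eqxx.
Qed.

Lemma weight0 n : weight (0 : 'rV[F]_n) = 0%N.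
Proof. by apply/eqP; rewrite weight_eq0. Qed.

Definition systematic k m (A : 'M[F]_(k, m)) : linear_code F :=
  gencode (row_mx 1%:M A).

Lemma systematic_free k m (A : 'M[F]_(k, m)) : row_free (row_mx 1%:M A).
Proof.
apply/row_freeP; exists (col_mx 1%:M 0).
by rewrite mul_row_col mulmx1 mulmx0 addr0.
Qed.

Lemma dim_systematic k m (A : 'M[F]_(k, m)) :
  \dim (codewords (systematic A)) = k.
Proof. exact/dim_gencode/systematic_free. Qed.

Lemma mem_systematic k m (A : 'M[F]_(k, m)) (u : 'rV_k) (v : 'rV_m) :
  (row_mx u v \in codewords (systematic A)) = (v == u *m A).
Proof.
apply/mem_gencode/eqP => [[w]|->]; last first.
  by exists u; rewrite mul_mx_row mulmx1.
by rewrite mul_mx_row mulmx1 => /eq_row_mx[-> ->].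
Qed.

Lemma systematicP k m (A : 'M[F]_(k, m)) (x : 'rV_(k + m)) :
  reflect (exists u, x = row_mx u (u *m A)) (x \in codewords (systematic A)).
Proof.
apply: (iffP (mem_gencode _ _)) => [] [u ->]; exists u;
by rewrite mul_mx_row mulmx1.
Qed.

(** For the code with generator matrix [I | A], the words of weight at most m are
those that an MDS code must not contain. *)
Definition MDS_matrix k m (A : 'M[F]_(k, m)) :=
  forall u : 'rV_k, u != 0 -> (m < weight u + weight (u *m A))%N.

(** A nonzero word that vanishes on the first k coordinates has weight at most m,
so the projection of V to these coordinates is injective, hence onto. Preimages
of the unit vectors are the rows of [I | A]. *)
Lemma MDS_vspace_systematic k m (V : {vspace 'rV[F]_(k + m)}) :
  \dim V = k ->
  (forall x, x \in V -> x != 0 -> (m < weight x)%N) ->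
  exists A : 'M_(k, m), V = codewords (systematic A) /\ MDS_matrix A.
Proof.
move=> dimV wtV; pose f : 'Hom('rV[F]_(k + m), 'rV[F]_k) := linfun lsubmx.
have fE x : f x = lsubmx x by rewrite lfunE.
have kerV : (V :&: lker f)%VS = 0%VS.
  apply/eqP; rewrite -subv0; apply/subvP => x; rewrite memv_cap memv_ker fE.
  case/andP => xV /eqP x0; rewrite memv0; apply: contraT => /(wtV x xV).
  rewrite -(hsubmxK x) x0 weight_row_mx weight0.
  by rewrite ltnNge (leq_trans (max_card _)) ?card_ord.
have imV : (f @: V)%VS = fullv.
  apply/eqP; rewrite eqEdim subvf dimvf dim_matrix mul1r.
  by rewrite (limg_dim_eq kerV) dimV leqnn.
have: forall i, exists x, x \in V /\ f x = delta_mx 0 i :> 'rV_k.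
  move=> i; have: delta_mx 0 i \in (f @: V)%VS by rewrite imV memvf.
  by case/memv_imgP => x xV ->; exists x.
case/fin_all_exists => X XP.
pose G := \matrix_i X i; exists (rsubmx G).
have GE : G = row_mx 1%:M (rsubmx G).
  rewrite -{1}(hsubmxK G); congr row_mx; apply/row_matrixP => i.
  by rewrite row1 -(proj2 (XP i)) fE; apply/rowP => j; rewrite !mxE.
have sub : (codewords (systematic (rsubmx G)) <= V)%VS.
  apply/subvP => x /mem_gencode[u ->]; rewrite -GE mulmx_sum_row.
  by apply: memv_suml => i _; rewrite rowK memvZ ?(proj1 (XP i)).
have VE : V = codewords (systematic (rsubmx G)).
  by apply/esym/eqP; rewrite eqEdim sub dimV dim_systematic /=.
split=> // u u0; rewrite -weight_row_mx; apply: wtV.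
  by rewrite VE mem_systematic.
by rewrite -weight_eq0 weight_row_mx addn_eq0 weight_eq0 negb_and u0.
Qed.

(** The shape of A encodes 2 <= k <= n - 2. *)
Lemma nontrivial_MDS_systematic n k d (C : linear_code F) :
  nontrivial_MDS n k d C ->
  exists k' m' (A : 'M[F]_(k'.+2, m'.+2)),
    C = systematic A /\ MDS_matrix A.
Proof.
case=> [[lenC dimC [_ minC]] dE kn].
have {kn} [k' [m' [kE nE]]] : exists k' m', k = k'.+2 /\ n = (k'.+2 + m'.+2)%N.
  case/andP: kn => k2 kn; exists (k - 2)%N, (n - k - 2)%N.
  by split; lia.
case: C lenC dimC minC => n' V /= n'E dimV minV.
move: V dimV minV; rewrite n'E {}nE in dE * => V dimV minV {n'E n'}.
subst k; have [] := @MDS_vspace_systematic _ _ V dimV.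
  move=> x xV x0; have := minV x 0 xV (mem0v V) x0.
  by rewrite hamming_weight subr0 dE; lia.
by move=> A [-> mdsA]; exists k', m', A.
Qed.

End GeneratorMatrices.

(** * Monomial equivalence *)

Section Equivalence.
Variable F : finFieldType.

Definition monomial n n' (s : 'I_n' -> 'I_n) (a : 'I_n' -> F) (x : 'rV[F]_n) :
  'rV[F]_n' := \row_j (a j * x 0 (s j)).

Lemma monomial_inj n n' (s : 'I_n' -> 'I_n) a :
  bijective s -> (forall j, a j != 0) -> injective (monomial s a).
Proof.
case=> t _ sK a0 x y /rowP xy; apply/rowP => i.
by have := xy (t i); rewrite !mxE sK => /(mulfI (a0 _)).
Qed.

(** An inclusion suffices, since a monomial map is injective and the two codes
have the same number of words. *)
Lemma monomial_equivalent (C D : linear_code F)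
    (s : 'I_(code_length D) -> 'I_(code_length C)) a :
  bijective s -> (forall j, a j != 0) ->
  \dim (codewords C) = \dim (codewords D) ->
  (forall x, x \in codewords C -> monomial s a x \in codewords D) ->
  equivalent C D.
Proof.
move=> bij_s a0 dimCD sub; exists s, a; split=> //.
apply/esym/eqP; rewrite eqEcard; apply/andP; split.
  by apply/subsetP => _ /imsetP[x xC ->]; rewrite inE; apply: sub.
rewrite (card_imset _ (monomial_inj bij_s a0)) cardsE.
by rewrite !card_vspace dimCD.
Qed.

Lemma weight_monomial n n' (s : 'I_n' -> 'I_n) a (x : 'rV_n) :
  bijective s -> (forall j, a j != 0) -> weight (monomial s a x) = weight x.
Proof.
move=> [t sK tK] a0; rewrite !weightE [RHS](reindex s) /=; last first.
  by exists t => i _; [apply: sK | apply: tK].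
by apply: eq_bigr => j _; rewrite mxE mulf_eq0 (negPf (a0 j)).
Qed.

Lemma equivalent_refl (C : linear_code F) : equivalent C C.
Proof.
apply: (@monomial_equivalent C C id (fun=> 1)) => // [|_|x xC].
- by exists id.
- exact: oner_neq0.
by have -> : monomial id (fun=> 1) x = x by apply/rowP => j; rewrite mxE mul1r.
Qed.

Lemma equivalent_trans (C D E : linear_code F) :
  equivalent C D -> equivalent D E -> equivalent C E.
Proof.
move=> [s [a [bij_s a0 CD]]] [t [b [bij_t b0 DE]]].
exists (s \o t), (fun j => b j * a (t j)); split.
- exact: bij_comp.
- by move=> j; rewrite mulf_neq0.
have inD x : (x \in codewords D) = (x \in [set y | y \in codewords D]).
  by rewrite inE.
rewrite DE; apply/setP => z; apply/imsetP/imsetP => [[y]|[x xC ->]].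
  rewrite inD CD => /imsetP[x xC ->] ->; exists x => //.
  by apply/rowP => j; rewrite !mxE mulrA.
exists (monomial s a x); first by rewrite inD CD; apply/imsetP; exists x.
by apply/rowP => j; rewrite !mxE mulrA.
Qed.

Lemma equivalent_length (C D : linear_code F) :
  equivalent C D -> code_length C = code_length D.
Proof.
by case=> s [a [bij_s _ _]]; have := bij_eq_card bij_s; rewrite !card_ord.
Qed.

(** Equivalent codes have equally many words, and a code of dimension k has
#|F| ^ k of them. *)
Lemma equivalent_dim (C D : linear_code F) :
  equivalent C D -> \dim (codewords C) = \dim (codewords D).
Proof.
case=> s [a [bij_s a0 CD]].
have: #|codewords D| = #|codewords C|.
  have := congr1 (fun A : {set _} => #|A|) CD.
  by rewrite (card_imset _ (monomial_inj bij_s a0)) cardsE.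
by rewrite !card_vspace => /(expnI (card_finNzRing_gt1 F)).
Qed.

(** The map permutes the information coordinates by s and the check coordinates
by t; the row factors r are undone on the information coordinates, so that the
image is again systematic. *)
Lemma systematic_equivalent k m (A B : 'M[F]_(k, m)) s t r c :
  bijective s -> bijective t ->
  (forall i, r i != 0) -> (forall j, c j != 0) ->
  (forall i j, B i j = r i * A (s i) (t j) * c j) ->
  equivalent (systematic A) (systematic B).
Proof.
move=> [s' sK s'K] [t' tK t'K] r0 c0 BE.
pose glue T (f : 'I_k -> T) (g : 'I_m -> T) (i : 'I_(k + m)) :=
  match split i with inl i => f i | inr j => g j end.
pose st f g := glue _ (fun i : 'I_k => lshift m (f i : 'I_k))
                      (fun j : 'I_m => rshift k (g j : 'I_m)).
have glueK T f g (u : 'I_k + 'I_m) : @glue T f g (unsplit u) =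
    match u with inl i => f i | inr j => g j end by rewrite /glue unsplitK.
pose a := glue _ (fun i => (r i)^-1) c.
apply: (@monomial_equivalent (systematic A) (systematic B) (st s t) a).
- exists (st s' t') => i; rewrite -(splitK i) /st glueK; case: (split i) => j.
  + by rewrite (glueK _ _ _ (inl (s j))) sK.
  + by rewrite (glueK _ _ _ (inr (t j))) tK.
  + by rewrite (glueK _ _ _ (inl (s' j))) s'K.
  by rewrite (glueK _ _ _ (inr (t' j))) t'K.
- move=> j; rewrite /a -(splitK j) glueK; case: (split j) => i //.
  by rewrite invr_eq0.
- by rewrite !dim_systematic.
move=> x /systematicP[u ->].
have -> : monomial (st s t) a (row_mx u (u *m A)) =
    row_mx (\row_i ((r i)^-1 * u 0 (s i))) (\row_j (c j * (u *m A) 0 (t j))).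
  apply/rowP => j; rewrite mxE /a /st -(splitK j) !glueK.
  case: (split j) => i /=.
    by rewrite !row_mxEl mxE.
  by rewrite !row_mxEr mxE.
rewrite mem_systematic; apply/eqP/rowP => j.
rewrite !mxE mulr_sumr (reindex s) /=; last by exists s' => i _.
apply: eq_bigr => i _; rewrite !mxE BE; field.
exact: r0.
Qed.

(** For matrices without zero entries, the numbers A i j * A 0 0 / (A i 0 * A 0 j)
determine A up to row and column scaling. The hypothesis equates them for the
permuted A and for B, with denominators cleared so that it can be tested on
integer representatives. *)
Lemma cross_ratio_equivalent k m (A B : 'M[F]_(k.+1, m.+1)) s t :
  bijective s -> bijective t ->
  (forall i j, A i j != 0) -> (forall i j, B i j != 0) ->
  (forall i j, A (s i) (t j) * A (s 0) (t 0) * B i 0 * B 0 j =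
               A (s i) (t 0) * A (s 0) (t j) * B i j * B 0 0) ->
  equivalent (systematic A) (systematic B).
Proof.
move=> bij_s bij_t A0 B0 AB.
pose r i := B i 0 / A (s i) (t 0).
pose c j := A (s 0) (t 0) * B 0 j / (A (s 0) (t j) * B 0 0).
apply: (@systematic_equivalent _ _ A B s t r c) => // [i|j|i j].
- by rewrite !(mulf_neq0, invr_eq0).
- by rewrite !(mulf_neq0, invr_eq0).
have d0 : A (s i) (t 0) * A (s 0) (t j) * B 0 0 != 0 by rewrite !mulf_neq0.
apply: (mulIf d0); transitivity (A (s i) (t 0) * A (s 0) (t j) * B i j * B 0 0).
  by ring.
rewrite -AB /r /c; field.
by rewrite !A0 !B0.
Qed.

(** The columns of [I | harmonic a] are four points of the projective line with
cross-ratio a. *)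
Definition harmonic (a : F) : 'M[F]_2 :=
  \matrix_(i, j) (if (i == 1) && (j == 1) then a else 1).

Lemma mem_harmonic (a : F) (x : 'rV[F]_(2 + 2)) :
  (x \in codewords (systematic (harmonic a))) =
    (x 0 (rshift 2 0) == x 0 (lshift 2 0) + x 0 (lshift 2 1)) &&
    (x 0 (rshift 2 1) == x 0 (lshift 2 0) + a * x 0 (lshift 2 1)).
Proof.
have col0 (u : 'rV[F]_2) : (u *m harmonic a) 0 0 = u 0 0 + u 0 1.
  rewrite mxE !big_ord_recl big_ord0 !mxE /= !mulr1 addr0.
  by congr (_ + u 0 _); apply: val_inj.
have col1 (u : 'rV[F]_2) : (u *m harmonic a) 0 1 = u 0 0 + a * u 0 1.
  rewrite mxE !big_ord_recl big_ord0 !mxE /= !mulr1 addr0 mulrC.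
  by congr (_ + a * u 0 _); apply: val_inj.
rewrite -[x in LHS]hsubmxK mem_systematic.
apply/eqP/andP => [/rowP xE|[/eqP x0 /eqP x1]].
  by have := xE 0; have := xE 1; rewrite col0 col1 !mxE => -> ->.
apply/rowP => j.
have [->|->] : j = 0 \/ j = 1.
  by case: j => [[|[|//]] ?]; [left|right]; apply: val_inj.
  by rewrite col0 !mxE.
by rewrite col1 !mxE.
Qed.

(** A permutation of four points of the projective line acts on their cross-ratio.
Row and column permutations of the redundancy matrix only produce a and 1 / a;
the exchange of an information coordinate with a check coordinate is what
produces a / (a - 1). *)
Lemma harmonic_equivalent (a : F) : a != 0 -> a != 1 ->
  equivalent (systematic (harmonic a)) (systematic (harmonic (a / (a - 1)))).
Proof.
move=> a0 a1; have a10 : a - 1 != 0 by rewrite subr_eq0.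
(* The word (u, v, u + v, u + a v) goes to (-u, u + v, v, (u + a v) / (a - 1)). *)
pose s : 'I_(2 + 2) -> 'I_(2 + 2) := tperm (lshift 2 1) (rshift 2 0).
pose b (j : 'I_(2 + 2)) : F :=
  if j == lshift 2 0 then -1 else if j == rshift 2 1 then (a - 1)^-1 else 1.
apply: (@monomial_equivalent (systematic _) (systematic _) s b).
- by exists s => i; rewrite /s tpermK.
- move=> j; rewrite /b; case: ifP => _; first by rewrite oppr_eq0 oner_eq0.
  by case: ifP; rewrite ?invr_eq0 ?oner_eq0.
- by rewrite !dim_systematic.
move=> x; rewrite !mem_harmonic.
case/andP=> /eqP x2 /eqP x3; rewrite !mxE /b /s tpermL tpermR !tpermD //=.
rewrite x2 x3; apply/andP; split; apply/eqP; first by ring.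
by field.
Qed.

(** * Minors of redundancy matrices *)

Lemma MDS_matrix_scale k m (A B : 'M[F]_(k, m)) r c :
  (forall i, r i != 0) -> (forall j, c j != 0) ->
  (forall i j, B i j = r i * A i j * c j) -> MDS_matrix A -> MDS_matrix B.
Proof.
move=> r0 c0 BE mdsA u u0; pose v := \row_i (u 0 i * r i).
have wv : weight v = weight u.
  by apply: eq_card => i; rewrite !inE mxE mulf_eq0 (negPf (r0 i)) orbF.
have -> : weight (u *m B) = weight (v *m A).
  apply: eq_card => j; rewrite !inE.
  have -> : (u *m B) 0 j = (v *m A) 0 j * c j.
    rewrite !mxE mulr_suml; apply: eq_bigr => i _.
    by rewrite BE mxE !mulrA.
  by rewrite mulf_eq0 (negPf (c0 j)) orbF.
by rewrite -wv; apply: mdsA; rewrite -weight_eq0 wv weight_eq0.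
Qed.

Definition nonzero_minors k m (A : 'M[F]_(k, m)) :=
  (forall i j, A i j != 0) /\
  (forall i i' j j', i != i' -> j != j' -> A i j * A i' j' != A i j' * A i' j).

(** The word (u, u A) has weight at most #|S| + (m - #|Z|) <= m. *)
Lemma MDS_matrix_vanish k m (A : 'M[F]_(k, m)) (u : 'rV_k)
    (S : {set 'I_k}) (Z : {set 'I_m}) :
  MDS_matrix A -> (forall i, i \notin S -> u 0 i = 0) ->
  (forall j, j \in Z -> (u *m A) 0 j = 0) -> (#|S| <= #|Z|)%N -> u = 0.
Proof.
move=> mdsA uS uZ SZ; apply/eqP; apply: contraT => /mdsA.
have wu : (weight u <= #|S|)%N.
  apply/subset_leq_card/subsetP => i; rewrite inE.
  by apply: contraNT => /uS ->.
have wuA : (weight (u *m A) <= #|~: Z|)%N.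
  apply/subset_leq_card/subsetP => j; rewrite !inE.
  by apply: contraNN => /uZ ->.
by have := cardsC Z; rewrite card_ord; lia.
Qed.

(** A zero entry, or a zero 2 x 2 minor, gives a combination of one row, or of two
rows, of A with one, or two, zeros: too light a word. *)
Lemma MDS_matrix_minors k m (A : 'M[F]_(k, m)) :
  MDS_matrix A -> nonzero_minors A.
Proof.
move=> mdsA.
have nz i j : A i j != 0.
  apply/eqP => Aij.
  suff /rowP/(_ i)/eqP : delta_mx 0 i = 0 :> 'rV[F]_k.
    by rewrite !mxE !eqxx oner_eq0.
  apply: (MDS_matrix_vanish (S := [set i]) (Z := [set j]) mdsA).
  - by move=> l; rewrite inE mxE => /negPf ->; rewrite andbF.
  - by move=> l; rewrite inE -rowE mxE => /eqP ->.
  by rewrite !cards1.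
split=> // i i' j j' ii' jj'; apply/eqP => det0.
(* This combination of rows i and i' vanishes in column j, and in column j' up to
   the minor. *)
pose u : 'rV[F]_k := A i' j *: delta_mx 0 i - A i j *: delta_mx 0 i'.
have uA l : (u *m A) 0 l = A i' j * A i l - A i j * A i' l.
  by rewrite mulmxBl -!scalemxAl -!rowE !mxE.
suff /rowP/(_ i)/eqP : u = 0.
  by rewrite !mxE !eqxx (negPf ii') /= mulr0 subr0 mulr1 (negPf (nz _ _)).
apply: (MDS_matrix_vanish (S := [set i; i']) (Z := [set j; j']) mdsA).
- move=> l; rewrite !inE !mxE /= negb_or => /andP[/negPf -> /negPf ->].
  by rewrite !mulr0 subr0.
- move=> l; rewrite !inE uA => /orP[] /eqP ->; apply/eqP; rewrite subr_eq0.
    by rewrite mulrC.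
  by rewrite det0 mulrC.
by rewrite !cards2 ii' jj'.
Qed.

Lemma nonzero_minors_sub k m k' m' (A : 'M[F]_(k, m))
    (f : 'I_k' -> 'I_k) (g : 'I_m' -> 'I_m) :
  injective f -> injective g -> nonzero_minors A ->
  nonzero_minors (mxsub f g A).
Proof.
move=> inj_f inj_g [nz det]; split=> [i j|i i' j j' ii' jj']; rewrite !mxE //.
by apply: det; rewrite ?(inj_eq inj_f) ?(inj_eq inj_g).
Qed.

(** The representative of A, up to row and column scaling, whose first row and
column consist of ones. *)
Definition normalize k m (A : 'M[F]_(k.+1, m.+1)) : 'M[F]_(k.+1, m.+1) :=
  \matrix_(i, j) ((A i 0)^-1 * A i j * (A 0 0 / A 0 j)).

Lemma normalize_minors k m (A : 'M[F]_(k.+1, m.+1)) :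
  nonzero_minors A -> nonzero_minors (normalize A).
Proof.
case=> nz det; split=> [i j|i i' j j' ii' jj']; rewrite !mxE.
  by rewrite !mulf_neq0 ?invr_eq0.
have {det} := det i i' j j' ii' jj'; apply: contraNN => /eqP E; apply/eqP.
pose p := (A i 0)^-1 * (A i' 0)^-1 * (A 0 0 / A 0 j) * (A 0 0 / A 0 j').
have p0 : p != 0 by rewrite !mulf_neq0 ?invr_eq0.
apply: (mulfI p0); rewrite /p; transitivity ((A i 0)^-1 * A i j * (A 0 0 / A 0 j) *
  ((A i' 0)^-1 * A i' j' * (A 0 0 / A 0 j'))); first by ring.
by rewrite E; ring.
Qed.

End Equivalence.

(** * Distances to a coset, over integer representatives modulo 5 *)

Definition words (T : Type) (a : seq T) n : seq (seq T) :=
  iter n (fun ws => [seq x :: w | x <- a, w <- ws]) [:: [::]].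

Lemma mem_words (T : eqType) (a : seq T) n w :
  (w \in words a n) = (size w == n) && all (mem a) w.
Proof.
elim: n w => [|n IHn] [|x w] //=.
  by apply/allpairsP => -[[y v] []].
rewrite eqSS andbCA -IHn; apply/allpairsP/andP => [[[y v] [/= ya vw [-> ->]]]|].
  by [].
by case=> xa ww; exists (x, w).
Qed.

Definition entry (rows : seq (seq nat)) i j : nat := nth 0%N (nth [::] rows i) j.

Definition vec m (s : seq nat) : 'rV['F_5]_m := \row_j (nth 0%N s j)%:R.

(** Entries are given by integer representatives, so that equations over F_5
become statements on divisibility by 5 which are decided by computation. *)
Definition mat k m (rows : seq (seq nat)) : 'M['F_5]_(k, m) :=
  \matrix_(i, j) (entry rows i j)%:R.

Lemma natF5_eq0 n : ((n%:R : 'F_5) == 0) = (5 %| n)%N.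
Proof. by rewrite (dvdn_pcharf (pchar_Fp (isT : prime 5))). Qed.

Lemma natF5_eq a b : ((a%:R : 'F_5) == b%:R) = (a == b %[mod 5])%N.
Proof.
wlog le_ab : a b / (b <= a)%N => [wlog_ab|].
  case/orP: (leq_total b a) => [|/wlog_ab E]; first exact: wlog_ab.
  by rewrite eq_sym E eq_sym.
by rewrite -subr_eq0 -natrB // natF5_eq0 eqn_mod_dvd.
Qed.

Lemma sum_F5 (g : 'F_5 -> nat) :
  (\sum_(c : 'F_5) g c = \sum_(c <- iota 0 5) g c%:R)%N.
Proof.
rewrite -[iota 0 5]/(index_iota 0 5) big_mkord.
by apply: (eq_bigr (fun c : 'I_5 => g (c : nat)%:R)) => c _; rewrite natr_Zp.
Qed.

(** The numbers weight u + weight (s + u A) for all u, where A has the given rows: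
each step runs through one coordinate c of u and adds c times a row to s. Zeros
modulo 5 are only counted at the end, so no reduction is done on the way. *)
Fixpoint distances (rows : seq (seq nat)) (s : seq nat) : seq nat :=
  if rows is r :: rows' then
    flatten [seq [seq ((c != 0) + w)%N
                   | w <- distances rows' [seq (p.1 + c * p.2)%N | p <- zip s r]]
               | c <- iota 0 5]
  else [:: count (fun x => ~~ (5 %| x)%N) s].

Definition rect k m (rows : seq (seq nat)) :=
  (size rows == k) && all (fun r => size r == m) rows.

Lemma weight_vec m s : size s = m ->
  weight (vec m s) = count (fun x => ~~ (5 %| x)%N) s.
Proof.
move=> sz_s; rewrite weightE -sum1_count [RHS]big_mkcond (big_nth 0%N) sz_s big_mkord.
by apply: eq_bigr => j _; rewrite mxE natF5_eq0; case: (_ %| _)%N.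
Qed.

Lemma sum_rowS k (g : 'rV['F_5]_k.+1 -> nat) :
  (\sum_u g u =
   \sum_(c <- iota 0 5) \sum_(v : 'rV_k) g (row_mx (c%:R%:M : 'rV_1) v))%N.
Proof.
pose h (p : 'F_5 * 'rV['F_5]_k) : 'rV_k.+1 := row_mx (p.1%:M : 'rV_1) p.2.
rewrite (reindex h) /=; last first.
  exists (fun u : 'rV_(1 + k) => (lsubmx u 0 0, rsubmx u)) => [[c v]|u] _.
    by rewrite /= row_mxKl row_mxKr mxE.
  by rewrite /h /= -mx11_scalar hsubmxK.
by rewrite -(sum_F5 (fun c => \sum_v g (h (c, v)))%N) pair_big; apply: eq_bigr => -[].
Qed.

Lemma mat_cons k m r rows :
  mat (1 + k) m (r :: rows) = col_mx (vec m r) (mat k m rows).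
Proof.
apply/matrixP => i j; rewrite !mxE; case: splitP => i' ->; rewrite !mxE //.
by rewrite ord1.
Qed.

Lemma vec_addmul m s r c : size s = m -> size r = m ->
  vec m [seq (p.1 + c * p.2)%N | p <- zip s r] = vec m s + c%:R *: vec m r.
Proof.
move=> sz_s sz_r; apply/rowP => j.
rewrite !mxE (nth_map (0%N, 0%N)) ?size_zip ?sz_s ?sz_r ?minnn //.
by rewrite nth_zip ?sz_s ?sz_r //= natrD natrM.
Qed.

Lemma distances_cons r rows s : distances (r :: rows) s =
  flatten [seq [seq ((c != 0) + w)%N
                 | w <- distances rows [seq (p.1 + c * p.2)%N | p <- zip s r]]
             | c <- iota 0 5].
Proof. by []. Qed.

(** The predicate is arbitrary because the induction on the rows replaces P by its
shift by 1 when the coordinate that is split off is nonzero. *)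
Lemma count_distances k m rows s (P : pred nat) :
  rect k m rows -> size s = m ->
  #|[set u : 'rV['F_5]_k | P (weight u + weight (vec m s + u *m mat k m rows))%N]|
  = count P (distances rows s).
Proof.
move=> rect_rows sz_s; rewrite -sum1dep_card [LHS]big_mkcond /=.
transitivity (\sum_(u : 'rV['F_5]_k)
   P (weight u + weight (vec m s + u *m mat k m rows))%N)%N.
  by apply: eq_bigr => u _; case: (P _).
elim: rows k s P rect_rows sz_s => [|r rows IH] k s P.
  case/andP=> /eqP <- _ sz_s; rewrite (big_pred1 0) => [|u]; last first.
    by rewrite (thinmx0 u) /= eqxx.
  by rewrite /= mul0mx addr0 weight_vec // addn0 weight0.
case/andP=> /eqP <- /andP[/eqP sz_r rect_rows] sz_s.
rewrite sum_rowS distances_cons count_flatten -map_comp sumnE big_map.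
rewrite [LHS]big_seq [RHS]big_seq; apply: eq_bigr => c.
rewrite mem_iota /= => c5; rewrite count_map.
have rect_rows' : rect (size rows) m rows by apply/andP.
rewrite -(IH _ _ _ rect_rows') ?size_map ?size_zip ?sz_s ?sz_r ?minnn //.
apply: eq_bigr => v _ /=; congr (nat_of_bool (P _)).
rewrite (weight_row_mx (_ : 'rV_1)) mat_cons (mul_row_col (_ : 'rV_1)).
rewrite mul_scalar_mx addrA -vec_addmul // addnA; congr (_ + _ + _)%N.
rewrite weightE big_ord1 mxE eqxx mulr1n natF5_eq0 /dvdn modn_small //.
Qed.

(** * Coset weight distributions and the properties they determine *)

Section CosetTables.
Variable F : finFieldType.
Implicit Type C : linear_code F.

Definition outer_distribution C (v : 'rV[F]_(code_length C)) : seq nat :=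
  [seq outer_count v t | t <- iota 0 (code_length C).+1].

Lemma nth_outer_distribution C (v : 'rV[F]_(code_length C)) t :
  (t <= code_length C)%N -> nth 0%N (outer_distribution v) t = outer_count v t.
Proof. by move=> le_t; rewrite (nth_map 0%N) ?size_iota // nth_iota. Qed.

Lemma hamming_dist_max n (x y : 'rV[F]_n) : (hamming_dist x y <= n)%N.
Proof. by rewrite (leq_trans (max_card _)) ?card_ord. Qed.

Definition first_nonzero (p : seq nat) := find (fun c => c != 0%N) p.

Lemma dist_to_codeP C (v x : 'rV[F]_(code_length C)) :
  x \in codewords C -> (dist_to_code v <= hamming_dist v x)%N.
Proof. by rewrite /dist_to_code; case: arg_minnP => [|y yC]; [apply: mem0v|apply]. Qed.

Lemma dist_to_code_attained C (v : 'rV[F]_(code_length C)) :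
  exists2 x, x \in codewords C & hamming_dist v x = dist_to_code v.
Proof.
rewrite /dist_to_code; case: arg_minnP => [|y yC _]; first exact: mem0v.
by exists y.
Qed.

Lemma outer_count_gt0 C (v : 'rV[F]_(code_length C)) t :
  reflect (exists2 x, x \in codewords C & hamming_dist v x = t)
          (0 < outer_count v t)%N.
Proof.
apply: (iffP card_gt0P) => [[x]|[x xC <-]].
  by rewrite !inE => /andP[xC /eqP]; exists x.
by exists x; rewrite !inE xC eqxx.
Qed.

(** This is how a distribution, taken as a bare list, remembers the distance to
the code. *)
Lemma first_nonzero_outer_distribution C (v : 'rV[F]_(code_length C)) :
  first_nonzero (outer_distribution v) = dist_to_code v.
Proof.
have [x xC dx] := dist_to_code_attained v.
have le_d : (dist_to_code v <= code_length C)%N by rewrite -dx hamming_dist_max.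
have nz : nth 0%N (outer_distribution v) (dist_to_code v) != 0%N.
  by rewrite nth_outer_distribution // -lt0n; apply/(outer_count_gt0 v); exists x.
have lt_size : (dist_to_code v < size (outer_distribution v))%N.
  by rewrite size_map size_iota ltnS.
have [||//] := ltngtP (first_nonzero (outer_distribution v)) (dist_to_code v).
  move=> lt_find; have has_nz : has (fun c => c != 0%N) (outer_distribution v).
    by rewrite has_find (ltn_trans lt_find).
  have := nth_find 0%N has_nz.
  rewrite nth_outer_distribution; last by rewrite ltnW ?(leq_trans lt_find).
  rewrite -lt0n => /(outer_count_gt0 v)[y yC dy].
  by have := dist_to_codeP v yC; rewrite dy leqNgt lt_find.
by move=> /(before_find 0%N); rewrite nz.
Qed.

(** Although v ranges over the whole space, T can be short: the distribution only
depends on the coset of v, and many cosets share one. *)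
Definition distribution_table C (T : seq (seq nat)) :=
  (forall v : 'rV[F]_(code_length C), outer_distribution v \in T) /\
  (forall p, p \in T ->
     exists v : 'rV[F]_(code_length C), outer_distribution v = p).

(** Complete regularity says that the distance to the code determines the
distribution, that is, that the rows of T have different first nonzero places. *)
Lemma completely_regular_table C T :
  distribution_table C T -> uniq (map first_nonzero T) -> completely_regular C.
Proof.
move=> [inT _] uniqT v w t dvw.
have le_t : (t <= code_length C)%N by rewrite -ltnS.
suff: outer_distribution v = outer_distribution w.
  by move/(congr1 (nth 0%N ^~ t)); rewrite !nth_outer_distribution.
have /(nth_index [::]) := inT v; have /(nth_index [::]) := inT w.
have := inT v; have := inT w; rewrite -!index_mem.
set i := index _ T; set j := index _ T => ltj lti Ew Ev.
rewrite -Ev -Ew; congr nth; apply/eqP; rewrite -(nth_uniq 0%N _ _ uniqT) ?size_map //.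
by rewrite !(nth_map [::]) // Ev Ew !first_nonzero_outer_distribution dvw.
Qed.

Lemma covering_radius_table C T :
  distribution_table C T ->
  covering_radius C = (\max_(p <- T) first_nonzero p)%N.
Proof.
move=> [inT attained]; apply/eqP; rewrite eqn_leq; apply/andP; split.
  apply/bigmax_leqP => v _; rewrite -first_nonzero_outer_distribution.
  exact: leq_bigmax_seq (inT v) isT.
apply/bigmax_leqP_seq => p /attained[v <-] _.
by rewrite first_nonzero_outer_distribution; apply: leq_bigmax.
Qed.

(** The rows at distance 0 are the distributions seen from the codewords; they
show the distances between codewords. *)
Lemma min_distance_table C T d :
  distribution_table C T -> (0 < d <= code_length C)%N ->
  all (fun p => (first_nonzero p == 0%N) ==>
         all (fun i => nth 0%N p i == 0%N) (iota 1 d.-1) && (0 < nth 0%N p d)%N) T ->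
  min_distance C d.
Proof.
move=> [inT _] /andP[d_gt0 le_d] /allP checkT.
have codeT (x : 'rV[F]_(code_length C)) : x \in codewords C ->
  (forall i, (0 < i < d)%N -> outer_count x i = 0%N) /\ (0 < outer_count x d)%N.
  move=> xC; have /implyP := checkT _ (inT x).
  have dx : dist_to_code x = 0%N.
    apply/eqP; rewrite -leqn0; have := dist_to_codeP x xC.
    by rewrite hamming_weight subrr weight0.
  rewrite first_nonzero_outer_distribution dx eqxx => /(_ isT)/andP[/allP zeros].
  rewrite nth_outer_distribution // => count_d; split=> // i /andP[i_gt0 lt_i].
  have /zeros : i \in iota 1 d.-1 by rewrite mem_iota; lia.
  by rewrite nth_outer_distribution => [/eqP|]; last exact: ltnW (leq_trans lt_i le_d).
split=> [|x y xC yC nxy].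
  have [_ /(outer_count_gt0 0)[y yC dy]] := codeT 0 (mem0v _).
  exists 0, y; split=> //; first exact: mem0v.
  apply: contraTneq d_gt0 => y0; rewrite -dy -y0 hamming_weight subrr.
  by rewrite weight0.
rewrite leqNgt; apply/negP => lt_d.
have [/(_ (hamming_dist x y)) zeros _] := codeT x xC.
have: (0 < outer_count x (hamming_dist x y))%N.
  by apply/(outer_count_gt0 x); exists y.
rewrite zeros // lt_d andbT lt0n hamming_weight weight_eq0 subr_eq0.
exact: nxy.
Qed.

(** Uniform packing is a finite linear system with one equation for each row of T. *)
Lemma uniformly_packed_wideP C T :
  distribution_table C T ->
  uniformly_packed_wide C <->
  exists b : nat -> rat, forall p, p \in T ->
    \sum_(i < (\max_(q <- T) first_nonzero q).+1) b i * (nth 0%N p i)%:R = 1.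
Proof.
move=> tabT; rewrite -(covering_radius_table tabT).
have le_r : (covering_radius C <= code_length C)%N.
  apply/bigmax_leqP => v _; have [x _ <-] := dist_to_code_attained v.
  exact: hamming_dist_max.
have sumE (b : nat -> rat) (v : 'rV[F]_(code_length C)) :
   \sum_(i < (covering_radius C).+1) b i * (nth 0%N (outer_distribution v) i)%:R =
   \sum_(i < (covering_radius C).+1) b i * (outer_count v i)%:R.
  apply: eq_bigr => i _; rewrite nth_outer_distribution //.
  by rewrite (leq_trans _ le_r) // -ltnS.
case: tabT => inT attained; split=> [[b bP]|[b bP]].
  exists (fun i => b (inord i)) => p /attained[v <-].
  rewrite (sumE (fun i => b (inord i))) -[RHS](bP v).
  by apply: eq_bigr => i _; rewrite inord_val.
by exists (fun i => b i) => v; rewrite -sumE; apply/bP/inT.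
Qed.

(** With v = (v1, v2) and the codeword (v1 - u, (v1 - u) A), the difference is
(u, s + u A) for the syndrome s = v2 - v1 A. *)
Lemma outer_count_systematic k m (A : 'M[F]_(k, m))
    (v : 'rV[F]_(code_length (systematic A))) t :
  outer_count v t =
  #|[set u : 'rV_k | weight u + weight (rsubmx (v : 'rV_(k + m)) -
       lsubmx (v : 'rV_(k + m)) *m A + u *m A) == t]%N|.
Proof.
set v1 := lsubmx _; set v2 := rsubmx _.
pose f u : 'rV_(k + m) := row_mx (v1 - u) ((v1 - u) *m A).
have fI : injective f by move=> u u' /eq_row_mx[/addrI/oppr_inj].
rewrite -(card_imset _ fI); apply: eq_card => x; rewrite !inE.
have hd u : hamming_dist (v : 'rV_(k + m)) (f u) =
    (weight u + weight (v2 - v1 *m A + u *m A)%R)%N.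
  rewrite hamming_weight -{1}(hsubmxK (v : 'rV_(k + m))) opp_row_mx add_row_mx.
  rewrite weight_row_mx -/v1 -/v2 opprB addrCA subrr addr0 mulmxBl.
  by rewrite opprB addrA addrAC.
apply/andP/imsetP => [[/systematicP[w xE] /eqP dx]|[u]].
  by exists (v1 - w); rewrite ?inE -?hd /f opprB addrCA subrr addr0 -xE ?dx.
rewrite inE -hd => /eqP dx ->; split; last by rewrite dx.
by apply/systematicP; exists (v1 - u).
Qed.

End CosetTables.

(** One distribution for each syndrome s, without repetition. *)
Definition coset_table k m rows :=
  undup [seq [seq count_mem t (distances rows s) | t <- iota 0 (k + m).+1]
        | s <- words (iota 0 5) m].

Lemma vec_surj m (v : 'rV['F_5]_m) :
  exists2 s, s \in words (iota 0 5) m & v = vec m s.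
Proof.
exists [seq nat_of_ord (v 0 j) | j <- enum 'I_m].
  rewrite mem_words size_map size_enum_ord eqxx; apply/allP => _ /mapP[j _ ->].
  by rewrite inE mem_iota; apply: (ltn_ord (v 0 j)).
apply/rowP => j; rewrite mxE (nth_map j) ?size_enum_ord // nth_ord_enum.
by rewrite natr_Zp.
Qed.

Lemma systematic_table k m rows :
  rect k m rows ->
  distribution_table (systematic (mat k m rows)) (coset_table k m rows).
Proof.
move=> rect_rows.
have odE (v : 'rV_(k + m)) s : size s = m ->
   rsubmx v - lsubmx v *m mat k m rows = vec m s ->
   outer_distribution (v : 'rV_(code_length (systematic (mat k m rows)))) =
   [seq count_mem t (distances rows s) | t <- iota 0 (k + m).+1].
  move=> sz_s vE; apply: eq_map => t.
  by rewrite outer_count_systematic vE -(count_distances _ rect_rows).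
split=> [v|p].
  have [s sw sE] := vec_surj (rsubmx (v : 'rV_(k + m)) -
                              lsubmx (v : 'rV_(k + m)) *m mat k m rows).
  have /andP[/eqP sz_s _] : (size s == m) && all (mem (iota 0 5)) s.
    by rewrite -mem_words.
  by rewrite mem_undup; apply/mapP; exists s; rewrite ?(odE _ s).
rewrite mem_undup => /mapP[s]; rewrite mem_words => /andP[/eqP sz_s _] ->.
exists (row_mx (0 : 'rV_k) (vec m s) : 'rV_(k + m)); apply: odE => //.
by rewrite row_mxKl row_mxKr mul0mx subr0.
Qed.

(** * Classification of the redundancy matrices over F_5 *)

Section Classification.
Local Open Scope nat_scope.

(** An entry 1 outside the first row and column would give a zero minor with three
of the ones, so 2, 3 and 4 are the only values. *)
Definition normalized k m : seq (seq (seq nat)) :=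
  [seq nseq m.+1 1 :: [seq 1 :: r | r <- M]
    | M <- words (words [:: 2; 3; 4] m) k].

Definition minors_rows k m (rows : seq (seq nat)) :=
  let e := entry rows in
  all (fun i => all (fun i' => (i == i') ||
    all (fun j => all (fun j' =>
      (j == j') || (e i j * e i' j' != e i j' * e i' j %[mod 5]))
    (iota 0 m)) (iota 0 m)) (iota 0 k)) (iota 0 k).

Definition MDS_rows m rows :=
  all (fun w => (w == 0) || (m < w)) (distances rows (nseq m 0)).

Definition regular_forms k m :=
  [seq rows <- normalized k m | minors_rows k.+1 m.+1 rows].

(** The minors are cheap to test and leave few arrays, whose codewords are then
enumerated. *)
Definition MDS_forms k m := [seq rows <- regular_forms k m | MDS_rows m.+1 rows].

(** The hypothesis of [cross_ratio_equivalent], modulo 5, for the permutations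
listed by p and q. *)
Definition match_rows k m (rows rows' : seq (seq nat)) p q :=
  let a i j := entry rows (nth 0 p i) (nth 0 q j) in
  let b := entry rows' in
  all (fun i => all (fun j =>
    a i j * a 0 0 * b i 0 * b 0 j == a i 0 * a 0 j * b i j * b 0 0 %[mod 5])
  (iota 0 m)) (iota 0 k).

Definition same_class k m rows rows' :=
  has (fun p => has (match_rows k m rows rows' p) (permutations (iota 0 m)))
      (permutations (iota 0 k)).

End Classification.

Lemma regular_form k m (A : 'M['F_5]_(k.+1, m.+1)) : nonzero_minors A ->
  exists2 rows, rows \in regular_forms k m & normalize A = mat k.+1 m.+1 rows.
Proof.
move=> /[dup] -[nz _] /normalize_minors; set N := normalize A => -[nzN detN].
have N_0 i : N i 0 = 1.
  by rewrite mxE mulVf // mul1r divff.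
have N0_ j : N 0 j = 1.
  by rewrite mxE mulrCA !mulrA mulfV // mul1r divff.
clearbody N.
pose M := [seq [seq nat_of_ord (N (lift ord0 i) (lift ord0 j))
                 | j <- enum 'I_m] | i <- enum 'I_k].
pose rows := nseq m.+1 1%N :: [seq 1%N :: r | r <- M].
have sz_M : size M = k by rewrite size_map size_enum_ord.
have nthS T (x y : T) s n : nth x (y :: s) n.+1 = nth x s n by [].
have NE : N = mat k.+1 m.+1 rows.
  apply/matrixP => i j; rewrite mxE /entry.
  case: (unliftP ord0 i) => [i' ->|->]; last first.
    change (N 0 j = (nth 0%N (nseq m.+1 1%N) j)%:R).
    by rewrite N0_ nth_nseq ltn_ord.
  rewrite lift0 nthS (nth_map [::]) ?sz_M //.
  rewrite (nth_map i') ?size_enum_ord // nth_ord_enum.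
  case: (unliftP ord0 j) => [j' ->|->]; last exact: N_0.
  rewrite lift0 nthS (nth_map j') ?size_enum_ord //.
  by rewrite nth_ord_enum natr_Zp.
exists rows => //; rewrite mem_filter; apply/andP; split; last first.
  apply/mapP; exists M => //; rewrite mem_words size_map size_enum_ord eqxx.
  apply/allP => _ /mapP[i _ ->] /=.
  rewrite mem_words size_map size_enum_ord eqxx.
  apply/allP => _ /mapP[j _ ->].
  have := nzN (lift ord0 i) (lift ord0 j).
  have : N (lift ord0 i) (lift ord0 j) != 1.
    have := detN 0 (lift ord0 i) 0 (lift ord0 j) isT isT.
    by rewrite !N_0 !N0_ !mul1r.
  by case: (N _ _) => [[|[|[|[|[|x]]]]]].
have NR i j : (i < k.+1)%N -> (j < m.+1)%N ->
    N (inord i) (inord j) = (entry rows i j)%:R.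
  by move=> lti ltj; rewrite NE mxE !inordK.
apply/allP => i; rewrite mem_iota => /andP[_ lti].
apply/allP => i'; rewrite mem_iota => /andP[_ lti'].
have [//|nii] := eqVneq i i'; apply/allP => j; rewrite mem_iota => /andP[_ ltj].
apply/allP => j'; rewrite mem_iota => /andP[_ ltj'].
have [//|njj] := eqVneq j j'.
rewrite -natF5_eq !natrM -!NR //; apply: detN.
  by apply: contraNneq nii => /(congr1 val); rewrite /= !inordK // => ->.
by apply: contraNneq njj => /(congr1 val); rewrite /= !inordK // => ->.
Qed.

Lemma rect_normalized k m rows :
  rows \in normalized k m -> rect k.+1 m.+1 rows.
Proof.
case/mapP=> M; rewrite mem_words => /andP[/eqP sz_M /allP MP] ->.
rewrite /rect /= size_map sz_M eqxx size_nseq eqxx; apply/allP => _ /mapP[r rM ->].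
by have := MP r rM; rewrite /= mem_words => /andP[/eqP ->].
Qed.

(** Scaling turns A into its normal form within its class and keeps it MDS. *)
Lemma MDS_form k m (A : 'M['F_5]_(k.+1, m.+1)) : MDS_matrix A ->
  exists rows, [/\ rows \in MDS_forms k m,
    nonzero_minors (mat k.+1 m.+1 rows) &
    equivalent (systematic A) (systematic (mat k.+1 m.+1 rows))].
Proof.
move=> mdsA; have regA := MDS_matrix_minors mdsA.
have [rows form_rows NE] := regular_form regA.
have regN := normalize_minors regA; case: (regA) => nz _.
pose r i := (A i 0)^-1; pose c j := A 0 0 / A 0 j.
have r0 i : r i != 0 by rewrite invr_eq0.
have c0 j : c j != 0 by rewrite mulf_neq0 ?invr_eq0.
have AN i j : normalize A i j = r i * A i j * c j by rewrite mxE.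
exists rows; rewrite -NE; split=> //; last first.
  by apply: (systematic_equivalent (s := id) (t := id) _ _ r0 c0 AN); exists id.
rewrite mem_filter form_rows andbT /MDS_rows.
have rect_rows : rect k.+1 m.+1 rows.
  by apply: rect_normalized; move: form_rows; rewrite mem_filter => /andP[].
have := count_distances (fun w => ~~ ((w == 0) || (m.+1 < w)))%N rect_rows
          (size_nseq m.+1 0%N).
rewrite eq_card0 => [|u]; last first.
  have -> : vec m.+1 (nseq m.+1 0%N) = 0.
    by apply/rowP => j; rewrite !mxE nth_nseq ltn_ord.
  rewrite inE add0r -NE; apply: negbTE; rewrite negbK.
  have [->|u0] := eqVneq u 0; first by rewrite mul0mx !weight0.
  by rewrite (MDS_matrix_scale r0 c0 AN mdsA) ?orbT.
by move=> count0; rewrite -[all _ _]negbK -has_predC has_count -count0.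
Qed.

(** A larger matrix contains a submatrix of the smaller shape, which inherits the
nonzero minors. *)
Lemma regular_forms_nil k m k' m' :
  regular_forms k m = [::] -> (k <= k')%N -> (m <= m')%N ->
  forall A : 'M['F_5]_(k'.+1, m'.+1), ~ nonzero_minors A.
Proof.
move=> no_form le_k le_m A.
have inj_w p q (le_pq : (p < q.+1)%N) : injective (widen_ord le_pq).
  by move=> i j /(congr1 val) /= ij; apply: val_inj.
move/(nonzero_minors_sub (inj_w k k' le_k) (inj_w m m' le_m))/regular_form.
by rewrite no_form => -[].
Qed.

Lemma permutation_inord n p :
  p \in permutations (iota 0 n.+1) ->
  bijective (fun i : 'I_n.+1 => inord (nth 0%N p i) : 'I_n.+1) /\
  forall i : 'I_n.+1, (nth 0%N p i < n.+1)%N.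
Proof.
rewrite mem_permutations => perm_p.
have sz_p : size p = n.+1 by rewrite (perm_size perm_p) size_iota.
have lt_p (i : 'I_n.+1) : (nth 0%N p i < n.+1)%N.
  have: nth 0%N p i \in p by rewrite mem_nth ?sz_p.
  by rewrite (perm_mem perm_p) mem_iota => /andP[].
split=> //; apply: injF_bij => i j /(congr1 val); rewrite /= !inordK //.
move/eqP; rewrite nth_uniq ?sz_p // => [/eqP/val_inj //|].
by rewrite (perm_uniq perm_p) iota_uniq.
Qed.

Lemma same_class_equivalent k m rows rows' :
  (forall i j, mat k.+1 m.+1 rows i j != 0) ->
  (forall i j, mat k.+1 m.+1 rows' i j != 0) ->
  same_class k.+1 m.+1 rows rows' ->
  equivalent (systematic (mat k.+1 m.+1 rows)) (systematic (mat k.+1 m.+1 rows')).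
Proof.
move=> nz nz' /hasP[p /permutation_inord[bij_p lt_p]].
case/hasP=> q /permutation_inord[bij_q lt_q] /allP match_pq.
apply: (cross_ratio_equivalent bij_p bij_q) => // i j.
have := match_pq i; rewrite mem_iota ltn_ord => /(_ isT)/allP/(_ j).
rewrite mem_iota ltn_ord => /(_ isT); rewrite -natF5_eq => /eqP.
by rewrite !natrM !mxE !inordK.
Qed.

Definition nonzero_rows k m rows :=
  rect k m rows && all (all (fun x => ~~ (5 %| x)%N)) rows.

Lemma nonzero_rowsP k m rows : nonzero_rows k m rows ->
  forall i j, mat k m rows i j != 0.
Proof.
case/andP=> /andP[/eqP sz_rows /allP sz_r] /allP nz i j.
have r_in : nth [::] rows i \in rows by rewrite mem_nth ?sz_rows.
have /allP nz_r := nz _ r_in; rewrite mxE natF5_eq0; apply/nz_r/mem_nth.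
by rewrite (eqP (sz_r _ r_in)).
Qed.

Lemma unique_MDS_class k m rows :
  nonzero_rows k.+1 m.+1 rows ->
  all (fun rows' => same_class k.+1 m.+1 rows' rows) (MDS_forms k m) ->
  forall A : 'M['F_5]_(k.+1, m.+1), MDS_matrix A ->
    equivalent (systematic A) (systematic (mat k.+1 m.+1 rows)).
Proof.
move=> nz /allP same A /MDS_form[rows' [/same same' [nz' _] eqA]].
apply: equivalent_trans eqA (same_class_equivalent nz' _ same').
exact: nonzero_rowsP.
Qed.

(** * Orthogonality over F_5 *)

(** The entries of [I | A] by plain indices, so that generators with different
splittings of the same n, such as 4 + 2 and 2 + 4, can be compared. *)
Definition gen_entry k rows i l : nat :=
  if (l < k)%N then (i == l : nat) else entry rows i (l - k).

Definition generator k n rows : 'M['F_5]_(k, n) :=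
  \matrix_(i, l) (gen_entry k rows i l)%:R.

Lemma generator_systematic k m rows :
  generator k (k + m) rows = row_mx 1%:M (mat k m rows).
Proof.
apply/matrixP => i l; rewrite !mxE /gen_entry; case: splitP => j ->.
  by rewrite mxE.
by rewrite addKn mxE.
Qed.

Definition orthogonal_rows k k' n rows rows' :=
  all (fun i => all (fun j =>
    (5 %| sumn [seq gen_entry k' rows' i l * gen_entry k rows j l | l <- iota 0 n])%N)
  (iota 0 k)) (iota 0 k').

Lemma orthogonal_generator k k' n rows rows' :
  orthogonal_rows k k' n rows rows' ->
  generator k' n rows' *m (generator k n rows)^T = 0.
Proof.
move=> /allP orth; apply/matrixP => i j; rewrite mxE [RHS]mxE; apply/eqP.
have := orth i; rewrite mem_iota ltn_ord => /(_ isT)/allP/(_ j).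
rewrite mem_iota ltn_ord => /(_ isT); rewrite -natF5_eq0 sumnE big_map.
rewrite -[n in iota 0 n]subn0 -/(index_iota 0 n) big_mkord natr_sum.
by congr (_ == 0); apply: eq_bigr => l _; rewrite !mxE natrM.
Qed.

(** By Fermat x * x is 1 or -1, and -1 = 1 + 3 modulo 5. *)
Lemma square_F5 (x : 'F_5) : x != 0 ->
  x * x = (1 + 3 * (x * x != 1)%R)%N%:R.
Proof. by case: x => [[|[|[|[|[|x]]]]]] //= i _; apply/eqP. Qed.

(** Three summands equal to 1 or -1 add up to 1, 3, -1 or -3, never to 0 modulo 5. *)
Lemma weight3_anisotropic n (x : 'rV['F_5]_n) : weight x = 3 -> inner x x != 0.
Proof.
move=> wx; pose S := [set i | x 0 i != 0].
have -> : inner x x = (\sum_(i in S) (1 + 3 * (x 0 i * x 0 i != 1)%R))%N%:R.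
  rewrite /inner natr_sum [RHS]big_mkcond; apply: eq_bigr => i _.
  by rewrite inE; case: eqP => [->|/eqP/square_F5] //; rewrite mul0r.
rewrite natF5_eq0 big_split /= sum1_card -big_distrr /=.
have : (\sum_(i in S) (x 0 i * x 0 i != 1)%R <= #|S|)%N.
  by rewrite -sum1_card; apply: leq_sum => i _; case: eqP.
have -> : #|S| = 3 by [].
by case: (\sum_(i in S) _)%N => [|[|[|[|c]]]].
Qed.

(** A word of weight 3 of D corresponds to one of C, which is not orthogonal to
itself. *)
Lemma min_distance3_not_self_dual (C D : linear_code 'F_5) :
  min_distance D 3 -> equivalent C D -> ~ self_dual C.
Proof.
move=> [[y [z [yD zD _ dyz]]] _] [s [a [bij_s a0 CD]]] sdC.
have : y - z \in [set y | y \in codewords D] by rewrite inE memvB.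
rewrite CD => /imsetP[x xC yzE].
have wx : weight x = 3.
  by rewrite -(weight_monomial x bij_s a0) /monomial -yzE -hamming_weight.
have /mem_dual_code/(_ x xC)/eqP : x \in codewords (dual_code C).
  by rewrite -[codewords (dual_code C)]sdC.
by rewrite (negPf (weight3_anisotropic wx)).
Qed.

Lemma systematic_MDS k m rows T :
  coset_table k m rows = T -> rect k m rows -> (2 <= k)%N -> (2 <= m)%N ->
  all (fun p => (first_nonzero p == 0%N) ==>
    all (fun i => nth 0%N p i == 0%N) (iota 1 m) && (0 < nth 0%N p m.+1)%N) T ->
  nontrivial_MDS (k + m) k m.+1 (systematic (mat k m rows)).
Proof.
move=> tabE rect_rows k2 m2 checkT; split; last 1 first.
- by rewrite k2; lia.
- split=> //; first exact: dim_systematic.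
  apply: (min_distance_table (systematic_table rect_rows)); last by rewrite tabE.
  by rewrite /=; lia.
by lia.
Qed.

(** * The six codes *)

(** The pairs rows42, rows24 and rows32, rows23 are chosen so that the codes are
dual to each other, and rows33 is a circulant matrix A with A A^T = -I. *)
Definition rows42 := [:: [:: 1; 3]; [:: 1; 4]; [:: 2; 2]; [:: 3; 1]]%N.
Definition rows24 := [:: [:: 1; 1; 1; 1]; [:: 1; 2; 3; 4]]%N.
Definition rows33 := [:: [:: 1; 3; 3]; [:: 3; 1; 3]; [:: 3; 3; 1]]%N.
Definition rows32 := [:: [:: 2; 2]; [:: 1; 4]; [:: 3; 1]]%N.
Definition rows23 := [:: [:: 1; 1; 1]; [:: 1; 2; 3]]%N.
Definition rows22 := [:: [:: 1; 1]; [:: 1; 3]]%N.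

(** In these tables every row lists the numbers of codewords at distance 0, 1, ...,
n from the vectors of some cosets. *)
Lemma table42 : coset_table 4 2 rows42 =
  [:: [:: 1; 0; 0; 80; 120; 264; 160]; [:: 0; 1; 10; 50; 155; 245; 164]]%N.
Proof. by vm_compute. Qed.

Lemma table24 : coset_table 2 4 rows24 =
  [:: [:: 1; 0; 0; 0; 0; 24; 0]; [:: 0; 0; 0; 4; 3; 12; 6];
      [:: 0; 0; 0; 2; 9; 6; 8]; [:: 0; 0; 0; 3; 6; 9; 7];
      [:: 0; 0; 1; 1; 6; 11; 6]; [:: 0; 1; 0; 0; 5; 15; 4]]%N.
Proof. by vm_compute. Qed.

Lemma table33 : coset_table 3 3 rows33 =
  [:: [:: 1; 0; 0; 0; 60; 24; 40]; [:: 0; 0; 2; 12; 27; 52; 32];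
      [:: 0; 1; 0; 10; 35; 45; 34]; [:: 0; 0; 3; 8; 33; 48; 33]]%N.
Proof. by vm_compute. Qed.

Lemma table32 : coset_table 3 2 rows32 =
  [:: [:: 1; 0; 0; 40; 40; 44]; [:: 0; 0; 10; 20; 55; 40];
      [:: 0; 1; 6; 26; 51; 41]]%N.
Proof. by vm_compute. Qed.

Lemma table23 : coset_table 2 3 rows23 =
  [:: [:: 1; 0; 0; 0; 20; 4]; [:: 0; 0; 0; 10; 5; 10];
      [:: 0; 0; 2; 4; 11; 8]; [:: 0; 0; 1; 7; 8; 9];
      [:: 0; 1; 0; 4; 13; 7]]%N.
Proof. by vm_compute. Qed.

Lemma table22 : coset_table 2 2 rows22 =
  [:: [:: 1; 0; 0; 16; 8]; [:: 0; 0; 6; 8; 11]; [:: 0; 1; 3; 11; 10]]%N.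
Proof. by vm_compute. Qed.

Lemma dual_systematic k k' n rows rows' :
  (k' + k = n)%N -> orthogonal_rows k k' n rows rows' ->
  row_free (generator k n rows) -> row_free (generator k' n rows') ->
  codewords (gencode (generator k' n rows')) =
  codewords (dual_code (gencode (generator k n rows))).
Proof.
move=> e orth free free'; apply: gencode_dual => //.
exact: orthogonal_generator.
Qed.

Lemma generator_free k m rows : row_free (generator k (k + m) rows).
Proof. by rewrite generator_systematic systematic_free. Qed.

Definition C643 := systematic (mat 4 2 rows42).
Definition C625 := systematic (mat 2 4 rows24).
Definition C634 := systematic (mat 3 3 rows33).
Definition C533 := systematic (mat 3 2 rows32).
Definition C524 := systematic (mat 2 3 rows23).
Definition C423 := systematic (mat 2 2 rows22).

Lemma C625_dual : C625 = dual_code C643.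
Proof.
rewrite /C625 /C643 /systematic -!generator_systematic.
congr LinearCode; apply: (@dual_systematic 4 2 6) => //.
- exact: (generator_free 4 2).
exact: (generator_free 2 4).
Qed.

Lemma C524_dual : C524 = dual_code C533.
Proof.
rewrite /C524 /C533 /systematic -!generator_systematic.
congr LinearCode; apply: (@dual_systematic 3 2 5) => //.
- exact: (generator_free 3 2).
exact: (generator_free 2 3).
Qed.

Lemma C634_self_dual : self_dual C634.
Proof.
rewrite /self_dual /C634 /systematic -!generator_systematic.
by apply: (@dual_systematic 3 3 6) => //; apply: (generator_free 3 3).
Qed.

Lemma C643_MDS : nontrivial_MDS 6 4 3 C643.
Proof. exact: (systematic_MDS table42). Qed.
Lemma C625_MDS : nontrivial_MDS 6 2 5 C625.
Proof. exact: (systematic_MDS table24). Qed.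
Lemma C634_MDS : nontrivial_MDS 6 3 4 C634.
Proof. exact: (systematic_MDS table33). Qed.
Lemma C533_MDS : nontrivial_MDS 5 3 3 C533.
Proof. exact: (systematic_MDS table32). Qed.
Lemma C524_MDS : nontrivial_MDS 5 2 4 C524.
Proof. exact: (systematic_MDS table23). Qed.
Lemma C423_MDS : nontrivial_MDS 4 2 3 C423.
Proof. exact: (systematic_MDS table22). Qed.

Lemma systematic_completely_regular k m rows T :
  coset_table k m rows = T -> rect k m rows -> uniq (map first_nonzero T) ->
  completely_regular (systematic (mat k m rows)).
Proof.
move=> <- rect_rows; apply: completely_regular_table.
exact: systematic_table.
Qed.

Lemma systematic_uniformly_packed k m rows T :
  coset_table k m rows = T -> rect k m rows ->
  uniformly_packed_wide (systematic (mat k m rows)) <->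
  exists b : nat -> rat, forall p, p \in T ->
    \sum_(0 <= i < (\max_(q <- T) first_nonzero q).+1) b i * (nth 0%N p i)%:R = 1.
Proof.
move=> <- rect_rows.
have /uniformly_packed_wideP -> := systematic_table rect_rows.
by split=> -[b bP]; exists b => p /bP; rewrite big_mkord.
Qed.

Lemma C643_completely_regular : completely_regular C643.
Proof. exact: (systematic_completely_regular table42). Qed.
Lemma C533_completely_regular : completely_regular C533.
Proof. exact: (systematic_completely_regular table32). Qed.
Lemma C423_completely_regular : completely_regular C423.
Proof. exact: (systematic_completely_regular table22). Qed.

(** The covering radius is 3, and two rows at distance 3 require 4 b 3 = 1 and
3 b 3 = 1. *)
Lemma C625_not_uniformly_packed : ~ uniformly_packed_wide C625.
Proof.
move/(systematic_uniformly_packed table24 isT); rewrite unlock => -[b bP].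
have := bP [:: 0; 0; 0; 4; 3; 12; 6]%N isT.
have := bP [:: 0; 0; 0; 3; 6; 9; 7]%N isT.
by rewrite /=; lra.
Qed.

(** The covering radius is 2, and the two rows at distance 2 require 2 b 2 = 1 and
3 b 2 = 1. *)
Lemma C634_not_uniformly_packed : ~ uniformly_packed_wide C634.
Proof.
move/(systematic_uniformly_packed table33 isT); rewrite unlock => -[b bP].
have := bP [:: 0; 0; 2; 12; 27; 52; 32]%N isT.
have := bP [:: 0; 0; 3; 8; 33; 48; 33]%N isT.
by rewrite /=; lra.
Qed.

(** There are five equations in four unknowns, but with b 3 = 1 / 10 the two rows at
distance 2, that is 2 b 2 + 4 b 3 = 1 and b 2 + 7 b 3 = 1, agree. *)
Lemma C524_uniformly_packed : uniformly_packed_wide C524.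
Proof.
apply/(systematic_uniformly_packed table23 isT).
pose b : seq rat := [:: 1; 6%:R / 10%:R; 3%:R / 10%:R; 10%:R^-1].
exists (fun i => b`_i); rewrite unlock => p.
by rewrite !inE => /or4P[|||/orP[]] /eqP -> /=; field.
Qed.

(** * Equivalence with one of the six codes *)

(** The normal forms are harmonic c for c = 2, 3, 4. Here 2 = 1 / 3 is reached
by a row or column exchange, and 4 / (4 - 1) = 3. *)
Lemma unique22 (A : 'M['F_5]_2) :
  MDS_matrix A -> equivalent (systematic A) C423.
Proof.
case/MDS_form=> rows [form_rows [nz _] eqA]; apply: equivalent_trans eqA _.
have formsE : MDS_forms 1 1 = [:: [:: [:: 1; 1]; [:: 1; 2]];
   [:: [:: 1; 1]; [:: 1; 3]]; [:: [:: 1; 1]; [:: 1; 4]]]%N by vm_compute.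
have nz22 := @nonzero_rowsP 2 2 rows22 isT.
move: form_rows nz; rewrite formsE !inE => /or3P[] /eqP -> nz.
- by apply: same_class_equivalent; last by vm_compute.
- exact: equivalent_refl.
have harmE c : mat 2 2 [:: [:: 1; 1]; [:: 1; c]]%N = harmonic c%:R.
  apply/matrixP => i j; rewrite !mxE.
  by case: i => [[|[|//]] ?]; case: j => [[|[|//]] ?].
rewrite /C423 /rows22 !harmE.
have <- : 4%:R / (4%:R - 1) = 3%:R :> 'F_5 by apply/eqP; vm_compute.
exact: harmonic_equivalent.
Qed.

Lemma unique23 (A : 'M['F_5]_(2, 3)) :
  MDS_matrix A -> equivalent (systematic A) C524.
Proof. by apply: unique_MDS_class; vm_compute. Qed.

Lemma unique24 (A : 'M['F_5]_(2, 4)) :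
  MDS_matrix A -> equivalent (systematic A) C625.
Proof. by apply: unique_MDS_class; vm_compute. Qed.

Lemma unique32 (A : 'M['F_5]_(3, 2)) :
  MDS_matrix A -> equivalent (systematic A) C533.
Proof. by apply: unique_MDS_class; vm_compute. Qed.

Lemma unique42 (A : 'M['F_5]_(4, 2)) :
  MDS_matrix A -> equivalent (systematic A) C643.
Proof. by apply: unique_MDS_class; vm_compute. Qed.

Lemma unique33 (A : 'M['F_5]_(3, 3)) :
  MDS_matrix A -> equivalent (systematic A) C634.
Proof. by apply: unique_MDS_class; vm_compute. Qed.

(** A matrix of any other shape contains a submatrix of shape 2 x 5, 5 x 2, 3 x 4 or
4 x 3, and every normal form of these shapes has a zero minor. *)
Lemma MDS_equivalent_one (T := [:: C643; C625; C634; C533; C524; C423]) n k d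
    (C : linear_code 'F_5) : nontrivial_MDS n k d C ->
  exists i : 'I_6, equivalent C (nth C643 T i).
Proof.
case/nontrivial_MDS_systematic=> k' [m' [A [-> mdsA]]].
have regA := MDS_matrix_minors mdsA.
have no_form K M : regular_forms K M = [::] -> (K <= k'.+1)%N -> (M <= m'.+1)%N -> False.
  by move=> nil le_k le_m; apply: (regular_forms_nil nil le_k le_m regA).
have no25 : (4 <= m'.+1)%N -> False.
  by move=> le_m; apply: (no_form 1%N 4%N) => //; vm_compute.
have no52 : (4 <= k'.+1)%N -> False.
  by move=> le_k; apply: (no_form 4%N 1%N) => //; vm_compute.
have no34 : (2 <= k'.+1)%N -> (3 <= m'.+1)%N -> False.
  by apply: (no_form 2%N 3%N); vm_compute.
have no43 : (3 <= k'.+1)%N -> (2 <= m'.+1)%N -> False.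
  by apply: (no_form 3%N 2%N); vm_compute.
have lt_k : (k' < 3)%N by rewrite ltnNge; apply/negP => /no52.
have lt_m : (m' < 3)%N by rewrite ltnNge; apply/negP => /no25.
case: k' A mdsA lt_k no34 no43 {regA no_form no25 no52} => [|[|[|//]]] A mdsA _;
  case: m' A mdsA lt_m => [|[|[|//]]] A mdsA _ no34 no43.
- by exists (inord 5); rewrite inordK //; apply: unique22.
- by exists (inord 4); rewrite inordK //; apply: unique23.
- by exists (inord 1); rewrite inordK //; apply: unique24.
- by exists (inord 3); rewrite inordK //; apply: unique32.
- by exists (inord 2); rewrite inordK //; apply: unique33.
- by case: (no34 isT isT).
- by exists (inord 0); rewrite inordK //; apply: unique42.
- by case: (no43 isT isT).
by case: (no34 isT isT).
Qed.

Local Close Scope ring_scope.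

(** The six pairs of length and dimension are distinct, and both are invariant
under equivalence. *)
Lemma equivalent_unique (C : linear_code 'F_5) (i j : 'I_6) :
  let T := [tuple C643; C625; C634; C533; C524; C423] in
  equivalent C (tnth T i) -> equivalent C (tnth T j) -> i = j.
Proof.
move=> T; pose lengths := [:: 6; 6; 6; 5; 5; 4]; pose dims := [:: 4; 2; 3; 3; 2; 2].
have params l : equivalent C (tnth T l) ->
    (nth 0 lengths l, nth 0 dims l) = (code_length C, \dim (codewords C)).
  move=> eqC.
  transitivity (code_length (tnth T l), \dim (codewords (tnth T l))).
    by rewrite (tnth_nth C643); case: l {eqC} => [[|[|[|[|[|[|//]]]]]] ?];
      congr pair; symmetry; apply: dim_systematic.
  by congr pair; [rewrite (equivalent_length eqC)|rewrite (equivalent_dim eqC)].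
move=> /params Ei /params Ej; move: (etrans Ei (esym Ej)) => {Ei Ej}.
by case: i => [[|[|[|[|[|[|//]]]]]] ?]; case: j => [[|[|[|[|[|[|//]]]]]] ?] //= _;
  apply: val_inj.
Qed.

Theorem theorem23 :
  exists C643 C625 C634 C533 C524 C423 : linear_code 'F_5,
  [/\ [/\ nontrivial_MDS 6 4 3 C643, completely_regular C643,
          nontrivial_MDS 6 2 5 C625, C625 = dual_code C643 &
          ~ uniformly_packed_wide C625],
      [/\ nontrivial_MDS 6 3 4 C634, ~ uniformly_packed_wide C634 &
          exists2 C : linear_code 'F_5, equivalent C C634 & self_dual C],
      [/\ nontrivial_MDS 5 3 3 C533, completely_regular C533,
          nontrivial_MDS 5 2 4 C524, C524 = dual_code C533 &
          uniformly_packed_wide C524],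
      [/\ nontrivial_MDS 4 2 3 C423, completely_regular C423 &
          forall C : linear_code 'F_5, equivalent C C423 -> ~ self_dual C] &
      forall (n k d : nat) (C : linear_code 'F_5), nontrivial_MDS n k d C ->
        exists! i : 'I_6,
          equivalent C (tnth [tuple C643; C625; C634; C533; C524; C423] i)].
Proof.
exists C643, C625, C634, C533, C524, C423; split.
- split; [exact: C643_MDS|exact: C643_completely_regular|exact: C625_MDS|
          exact: C625_dual|exact: C625_not_uniformly_packed].
- split; [exact: C634_MDS|exact: C634_not_uniformly_packed|].
  by exists C634; [apply: equivalent_refl|apply: C634_self_dual].
- split; [exact: C533_MDS|exact: C533_completely_regular|exact: C524_MDS|
          exact: C524_dual|exact: C524_uniformly_packed].
- split; [exact: C423_MDS|exact: C423_completely_regular|move=> C].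
  by apply: min_distance3_not_self_dual; case: C423_MDS => -[].
move=> n k d C /MDS_equivalent_one[i]; rewrite -tnth_nth => eqC.
by exists i; split=> // j; apply: equivalent_unique.
Qed.
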